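(* Let $a \ge 2$ be an integer. The set of bases $\beta \ge 2$ for which there exists an interesting reversed sum-product pair $(a,b)$ for the base $\beta$ (for some integer $b \ge a$) is the union of a nonzero finite number of arithmetic progressions modulo $a^2-1$, i.e. of sets of the form $\{(a^2-1)n + r : n = 0,1,2,\ldots\}$ with $r$ a positive integer.
   Context: A base-$\beta$ representation of a positive integer is canonical if it has no leading zero. A pair of positive integers $a \le b$ is a reversed sum-product pair for the base $\beta$ if the canonical base-$\beta$ representations of $a+b$ and $ab$ are the reverse of each other as digit strings (in particular they have the same number of digits). A reversed sum-product pair $(a,b)$ for the base $\beta$ is called interesting if it is neither $(2,2)$ nor $(\beta-1,\beta-1)$. *)

(* Defs.v *)
From mathcomp Require Import all_boot.
Set Implicit Arguments.
Unset Strict Implicit.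
Unset Printing Implicit Defensive.

(* Digit strings are written most significant digit first. *)
Definition digits_value (beta : nat) (s : seq nat) : nat :=
  foldl (fun acc d => acc * beta + d) 0 s.

(* The condition on the head rules out a leading zero, and also the empty
   string, so only positive integers have a canonical representation. *)
Definition canonical_repr (beta n : nat) (s : seq nat) : bool :=
  [&& all (fun d => d < beta) s, head 0 s != 0 & digits_value beta s == n].

(* For beta >= 2 canonical representations are unique, so s below is the
   canonical representation of a + b. *)
Definition reversed_sum_product_pair (beta a b : nat) : Prop :=
  0 < a <= b /\
  exists s : seq nat,
    canonical_repr beta (a + b) s /\ canonical_repr beta (a * b) (rev s).

Definition interesting_pair (beta a b : nat) : Prop :=
  [/\ reversed_sum_product_pair beta a b,
      (a, b) <> (2, 2) & (a, b) <> (beta - 1, beta - 1)].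

(* Main.v *)
Require Import Defs.
From mathcomp Require Import all_boot.
From mathcomp Require Import zify.
From mathcomp Require Import boolp.

(* Write S = a + b, so that a S - a^2 = ab is the digit reversal of S.  Feeding
   the term -a^2 in as an incoming carry, the multiplication by a reads
     a d_i + c_i = d_(n-i) + beta c_(i+1),   c_0 = -a^2,   c_(n+1) = 0.
   Solving these equations for i and n - i shows that
     (a^2 - 1) d_i = a (beta c_(i+1) - c_i) + (beta c_(n-i+1) - c_(n-i)),
   so replacing beta by beta + (a^2 - 1) with the same carries adds
   a c_(i+1) + c_(n-i+1) to d_i.  The new digits are admissible as soon as
   0 <= c_i <= a - 1 for i >= 1; the upper bound always holds, and a negative
   carry occurs only for (beta - 1, beta - 1).  One-digit sums give only (2, 2);
   with more digits the new pair is again interesting.  Hence the set of good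
   bases is closed under adding a^2 - 1.  It contains 3 a^2 + a - 4, the sum
   then having the two digits 4 and 4 a + 1. *)

(** * Digit strings indexed from the units digit *)

Definition low_part (beta : nat) (d : nat -> nat) (k : nat) : nat :=
  \sum_(i < k) d i * beta ^ i.

Lemma low_partS beta d k :
  low_part beta d k.+1 = low_part beta d k + d k * beta ^ k.
Proof. exact: big_ord_recr. Qed.

Lemma low_part0 beta d : low_part beta d 0 = 0.
Proof. exact: big_ord0. Qed.

Lemma eq_low_part beta d e k :
  (forall i, i < k -> d i = e i) -> low_part beta d k = low_part beta e k.
Proof. by move=> de; apply: eq_bigr => i _; rewrite de. Qed.

Lemma low_part_lt beta d k :
  (forall i, i < k -> d i < beta) -> low_part beta d k < beta ^ k.
Proof.
elim: k => [|k IHk] dlt; first by rewrite low_part0.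
rewrite low_partS expnS.
have := IHk (fun i ik => dlt i (ltnW ik)); have := dlt k (leqnn _); nia.
Qed.

Lemma low_part_mod beta d k m :
  k <= m -> low_part beta d m = low_part beta d k %[mod beta ^ k].
Proof.
elim: m => [|m IHm]; first by rewrite leqn0 => /eqP ->.
rewrite leq_eqVlt => /orP[/eqP -> //|]; rewrite ltnS => km.
have -> : low_part beta d m.+1 = d m * beta ^ (m - k) * beta ^ k + low_part beta d m.
  by rewrite low_partS -mulnA -expnD subnK // addnC.
by rewrite modnMDl IHm.
Qed.

Lemma digits_value_low_part beta s :
  digits_value beta s = low_part beta (nth 0 (rev s)) (size s).
Proof.
elim/last_ind: s => [|s x IHs]; first by rewrite low_part0.
rewrite /digits_value foldl_rcons -/(digits_value beta s) IHs size_rcons rev_rcons.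
rewrite /low_part big_ord_recl /= muln1 addnC big_distrl /=; congr (_ + _).
by apply: eq_bigr => i _; rewrite expnSr mulnA.
Qed.

(** Reversal becomes [i -> n - i]; [0 < d n] and [0 < d 0] say that neither the sum nor the product
    has a leading zero. *)
Lemma reversed_pair_digitsP beta a b :
  reversed_sum_product_pair beta a b <->
  0 < a <= b /\ exists n d,
    [/\ forall i, i <= n -> d i < beta, 0 < d 0, 0 < d n,
        a + b = low_part beta d n.+1 &
        a * b = low_part beta (fun i => d (n - i)) n.+1].
Proof.
split=> -[ab]; last first.
  case=> n [d [dlt d0 dn sumE prodE]]; split=> //.
  exists (rev (mkseq d n.+1)); rewrite /canonical_repr revK all_rev.
  have -> : all (fun x => x < beta) (mkseq d n.+1).
    by apply/allP => x /mapP[i]; rewrite mem_iota ltnS => /dlt ? ->.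
  rewrite -!nth0 nth_rev size_mkseq // subn1 !nth_mkseq //= -!lt0n d0 dn /=.
  rewrite !digits_value_low_part revK size_rev size_mkseq sumE prodE.
  split; apply/eqP; apply: eq_low_part => i iltn; first by rewrite nth_mkseq.
  by rewrite nth_rev size_mkseq // nth_mkseq subSS // ltnS leq_subr.
case=> s [/and3P[sall sh /eqP sumE] /and3P[_ rh /eqP prodE]]; split=> //.
case: s sall sh sumE rh prodE => // x s; set t := x :: s => tall th sumE rh prodE.
have tn i : i <= size s -> nth 0 (rev t) (size s - i) = nth 0 t i.
  by move=> le_i; rewrite nth_rev /= ?subSS ?subKn // ltnS leq_subr.
exists (size s), (nth 0 (rev t)); split.
- by move=> i le_i; apply: (allP tall); rewrite -mem_rev mem_nth // size_rev ltnS.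
- by rewrite nth0 lt0n.
- by rewrite -[X in nth _ _ X]subn0 tn // nth0 lt0n.
- by rewrite -sumE digits_value_low_part.
- rewrite -prodE digits_value_low_part revK size_rev.
  by apply: eq_low_part => i; rewrite ltnS => le_i; rewrite tn.
Qed.

(** * Size bounds and carries *)

Lemma lead_digit_lt beta d n :
  (forall i, i <= n -> d i < beta) ->
  low_part beta d n.+1 < (d n).+1 * beta ^ n.
Proof.
move=> dlt; rewrite low_partS.
have := @low_part_lt beta d n (fun i ik => dlt i (ltnW ik)); nia.
Qed.

(* [a] and [b] are the roots of [x^2 - (a + b) x + ab], and
   [w + 1 <= a <= b] makes this polynomial nonnegative at [w + 1], where
   [w = low_part beta d n.+1]; this forces the digit string [1 0 ... 0 w],
   and then [beta ^ n.+1 <= w + 2] leaves only two digits. *)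
Lemma low_part_ge beta a b n d :
  2 <= beta -> a <= b -> (a, b) <> (beta - 1, beta - 1) ->
  (forall i, i <= n.+1 -> d i < beta) -> 0 < d 0 -> 0 < d n.+1 ->
  a + b = low_part beta d n.+2 ->
  a * b = low_part beta (fun i => d (n.+1 - i)) n.+2 ->
  a <= low_part beta d n.+1.
Proof.
move=> beta2 le_ab nab dlt d0 dn sumE prodE; rewrite leqNgt; apply/negP => wa.
have elt i : i <= n.+1 -> d (n.+1 - i) < beta by move=> _; apply/dlt/leq_subr.
have Plt := lead_digit_lt _ _ _ elt; rewrite -prodE subnn in Plt.
have wB : low_part beta d n.+1 < beta ^ n.+1.
  by apply: low_part_lt => i /ltnW; apply: dlt.
have d0w : low_part beta d n.+1 = d 0 + \sum_(i < n) d i.+1 * beta ^ i.+1.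
  by rewrite /low_part big_ord_recl muln1.
rewrite low_partS in sumE.
have d0beta := dlt 0 isT.
move: prodE; rewrite low_partS subnn => prodE.
set w := low_part beta d n.+1 in wa wB d0w sumE.
set B := beta ^ n.+1 in Plt wB sumE prodE.
set s := d n.+1 in dn sumE.
have key : w.+1 * (s * B) <= a * b + w.+1 by nia.
(* The leading digit of [a * b] is [d 0 <= w], so [a * b < (d 0 + 1) * B]; with [key] this forces
   [s = 1], then [w = d 0]. *)
have s1 : s = 1 by nia.
have wd0 : w = d 0 by nia.
have zeros i : i < n -> d i.+1 = 0.
  move=> iltn; have /eqP : \sum_(i < n) d i.+1 * beta ^ i.+1 = 0 by lia.
  rewrite sum_nat_eq0 => /forallP/(_ (Ordinal iltn)) /=.
  by rewrite muln_eq0 expn_eq0 => /orP[/eqP // | /andP[/eqP]]; lia.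
have lowP : low_part beta (fun i => d (n.+1 - i)) n.+1 = 1.
  rewrite /low_part big_ord_recl subn0 muln1 -/s s1 big1 // => i _.
  have := ltn_ord i; rewrite lift0 subSS => iltn.
  by rewrite -[n - i]prednK ?subn_gt0 // zeros //; lia.
rewrite lowP in prodE.
have n0 : n = 0.
  have : B <= beta.+1 by nia.
  rewrite /B; case: n {dlt dn sumE prodE elt Plt wB d0w w wa key s s1 wd0 zeros lowP B} => // n.
  rewrite !expnS; have : 0 < beta ^ n by rewrite expn_gt0; lia.
  by nia.
have BE : B = beta by rewrite /B n0 expn1.
rewrite BE in sumE prodE key Plt.
(* Now [a + b = w + beta] and [a * b = w * beta + 1], so [(beta - a) * (beta - b) = 1]. *)
apply: nab; suff : a = beta - 1 /\ b = beta - 1 by case=> -> ->.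
have ab : a < beta by nia.
have bb : b < beta by nia.
nia.
Qed.

(* [c i] is the carry into position [i] when [low_part beta d m] is multiplied
   by [a] and the carry [- a ^ 2] enters at position [0]. *)
Lemma carries_exist beta a d e m :
  0 < a -> a <= d 0 ->
  (forall i, i < m -> d i < beta) -> (forall i, i < m -> e i < beta) ->
  a * low_part beta d m = a ^ 2 + low_part beta e m ->
  exists c : nat -> nat, forall i, 0 < i <= m ->
    c i < a /\ a * low_part beta d i = a ^ 2 + low_part beta e i + c i * beta ^ i.
Proof.
move=> a0 ad0 dlt elt eq_m.
exists (fun i => (a * low_part beta d i - a ^ 2) %/ beta ^ i) => i /andP[i0 im].
have Llt : low_part beta d i < beta ^ i.
  by apply: low_part_lt => j /leq_trans/(_ im); apply: dlt.
have Mlt : low_part beta e i < beta ^ i.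
  by apply: low_part_lt => j /leq_trans/(_ im); apply: elt.
(* The units digit alone covers [a ^ 2], so the truncated subtraction in the witness is exact. *)
have aL : a ^ 2 <= a * low_part beta d i.
  rewrite -(prednK i0) /low_part big_ord_recl muln1 -mulnn leq_pmul2l //.
  exact: leq_trans ad0 (leq_addr _ _).
split.
  rewrite ltn_divLR ?(leq_ltn_trans _ Llt) //.
  by rewrite (leq_ltn_trans (leq_subr _ _)) // ltn_pmul2l.
rewrite -addnA addnC; apply/eqP; rewrite -(subnK aL) eqn_add2r; apply/eqP.
rewrite addnK {1}(divn_eq (a * low_part beta d i - a ^ 2) (beta ^ i)) addnC.
(* The remainder is read off from [eq_m] modulo [beta ^ i]. *)
congr (_ + _); rewrite -[RHS](modn_small Mlt); apply/eqP.
rewrite -(eqn_modDl (a ^ 2)) subnKC // -modnMmr -(low_part_mod _ _ _ _ im) modnMmr.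
by rewrite eq_m -modnDmr (low_part_mod _ _ _ _ im) modnDmr.
Qed.

(** * Passing from [beta] to [beta + (a ^ 2 - 1)] *)

Lemma good_base_shift a beta b :
  2 <= a -> 2 <= beta -> a <= b -> interesting_pair beta a b ->
  exists b', a <= b' /\ interesting_pair (beta + (a ^ 2 - 1)) a b'.
Proof.
move=> a2 beta2 le_ab [/reversed_pair_digitsP[_ [n [d]]]].
case: n => [|n] [dlt d0 dn sumE prodE] nab2 nabbeta.
  case: nab2; move: prodE; rewrite (@eq_low_part _ _ d) => [|[]//].
  rewrite -sumE => prodE; suff : a = 2 /\ b = 2 by case=> -> ->.
  nia.
have wa := low_part_ge _ _ _ _ _ beta2 le_ab nabbeta dlt d0 dn sumE prodE.
set e := fun i => d (n.+1 - i) in prodE.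
have elt i : i <= n.+1 -> e i < beta by move=> _; apply/dlt/leq_subr.
have eqSP : a * low_part beta d n.+2 = a ^ 2 + low_part beta e n.+2.
  by rewrite -sumE -prodE; nia.
(* By [wa], [b >= beta ^ n.+1], while [a * b] has leading digit [d 0]. *)
have ad0 : a <= d 0.
  have := lead_digit_lt _ _ _ elt; rewrite -prodE /e subnn.
  rewrite low_partS in sumE; nia.
have [c cP] := carries_exist _ _ _ _ n.+2 (ltnW a2) ad0 dlt elt eqSP.
have cn : c n.+2 = 0.
  have [_] := cP n.+2 (leqnn _); rewrite eqSP => /eqP.
  rewrite -{1}[_ + low_part _ _ _]addn0 eqn_add2l eq_sym muln_eq0 expn_eq0.
  by case/orP => [/eqP //|/andP[/eqP]]; lia.
pose gamma := beta + (a ^ 2 - 1).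
(* The top index is [n.+1]; for [i <= n.+1] only carries into positive positions occur. *)
pose d' i := d i + a * c i.+1 + c (n.+2 - i).
pose e' i := d' (n.+1 - i).
have e'E i : i <= n.+1 -> e' i = e i + a * c (n.+2 - i) + c i.+1.
  by move=> le_i; rewrite /e' /d' /e (subSn le_i) (subSn (leq_subr i _)) subKn.
(* A digit grows by at most [a * (a - 1) + (a - 1) = a ^ 2 - 1]. *)
have d'lt i : i <= n.+1 -> d' i < gamma.
  move=> le_i; have := dlt i le_i; rewrite /d' /gamma.
  have [c1 _] : _ /\ _ := cP i.+1 le_i.
  have [c2 _] : _ /\ _ := cP (n.+2 - i) ltac:(lia).
  nia.
have shifted i : i <= n.+1 ->
    a * low_part gamma d' i.+1 = a ^ 2 + low_part gamma e' i.+1 + c i.+1 * gamma ^ i.+1.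
  elim: i => [|i IHi] le_i.
    have [_] := cP 1 isT; rewrite !low_partS !low_part0 !muln1 !expn1 e'E // /d' /gamma.
    nia.
  have [_ step1] := cP i.+1 ltac:(lia); have [_ step2] := cP i.+2 ltac:(lia).
  have step : a * d i.+1 + c i.+1 = e i.+1 + c i.+2 * beta.
    move: step2; rewrite !(low_partS _ _ i.+1) (expnS _ i.+1).
    have : 0 < beta ^ i.+1 by rewrite expn_gt0; lia.
    nia.
  have {}IHi := IHi (ltnW le_i).
  (* Both sides of [step] grow by [a * c (n.+1 - i) + a ^ 2 * c i.+2]. *)
  have step' : a * d' i.+1 + c i.+1 = e' i.+1 + c i.+2 * gamma.
    rewrite e'E // /d' /gamma; nia.
  rewrite !(low_partS _ _ i.+1) (expnS _ i.+1); nia.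
have eqSP' : a * low_part gamma d' n.+2 = a ^ 2 + low_part gamma e' n.+2.
  by rewrite shifted // cn mul0n addn0.
(* Hence the new [b'] is at least [gamma], which excludes both trivial pairs. *)
have Slarge : gamma + a <= low_part gamma d' n.+2.
  have d'n : 0 < d' n.+1 by rewrite /d'; lia.
  have d'0 : a <= d' 0 by rewrite /d'; lia.
  have gn : 0 < gamma ^ n by rewrite expn_gt0 /gamma; lia.
  rewrite addnC low_partS /low_part big_ord_recl muln1 leq_add //.
    exact: leq_trans d'0 (leq_addr _ _).
  by rewrite expnS mulnCA leq_pmulr // muln_gt0 d'n.
have gamma_a : a.+1 < gamma by rewrite /gamma; nia.
exists (low_part gamma d' n.+2 - a); split; first by lia.
split; last 2 first.
- by case; lia.
- by rewrite -/gamma; case; lia.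
apply/reversed_pair_digitsP; split; first by lia.
exists n.+1, d'; split => //.
- by rewrite /d'; lia.
- by rewrite /d'; lia.
- by rewrite subnKC //; lia.
- rewrite -/gamma -/e' mulnBr eqSP'; lia.
Qed.

(** * A first base, and the decomposition into progressions *)

Lemma interesting_pair_exists a :
  2 <= a -> interesting_pair (3 * a ^ 2 + a - 4) a (4 * (3 * a ^ 2 + a - 4) + 3 * a + 1).
Proof.
move=> a2; set beta := _ - 4.
have betaE : beta + 4 = 3 * a ^ 2 + a by rewrite /beta; nia.
split; [|by case; lia..].
split; first by nia.
(* By [betaE], [a * b = 4 * a * beta + (3 * a ^ 2 + a) = (4 * a + 1) * beta + 4]. *)
exists [:: 4; 4 * a + 1].
by split; apply/and3P; rewrite /digits_value /rev /=; split; nia.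
Qed.

(** In each residue class modulo [K] that meets [S], the least element of [S] generates all the
    others. *)
Lemma shift_closed_progressions (S : nat -> Prop) (K : nat) :
  0 < K -> (forall x, S x -> S (x + K)) ->
  exists rs : seq nat, forall x,
    S x <-> exists r, r \in rs /\ exists n, x = K * n + r.
Proof.
move=> K0 Sshift.
have Sprog r n : S r -> S (K * n + r).
  move=> Sr; elim: n => [|n IHn]; first by rewrite muln0.
  by rewrite mulnS -addnA addnC; apply: Sshift.
suff [rs [rsS rsP]] : exists rs : seq nat, (forall r, r \in rs -> S r) /\
    forall x, x %% K < K -> S x -> exists r, r \in rs /\ exists n, x = K * n + r.
  exists rs => x; split=> [Sx | [r [/rsS Sr [n ->]]]]; last exact: Sprog.
  by apply: rsP; rewrite ?ltn_pmod.
(* Induction on the bound below which residues are already treated. *)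
elim: {2}K => [|j [rs [rsS rsP]]]; first by exists [::].
case: (pselect (exists x, `[< S x >] && (x %% K == j))) => [ex|nex].
  case: (ex_minnP ex) => m /andP[/asboolP Sm /eqP mj] m_min.
  exists (m :: rs); split=> [r | x].
    by rewrite inE => /orP[/eqP -> //|]; apply: rsS.
  rewrite ltnS leq_eqVlt => /orP[/eqP xj Sx | xj Sx].
    exists m; rewrite mem_head; split=> //; exists ((x - m) %/ K).
    have le_mx : m <= x by apply: m_min; rewrite xj eqxx andbT; apply/asboolP.
    by rewrite mulnC divnK ?subnK // -eqn_mod_dvd // xj mj.
  by have [r [rrs rx]] := rsP x xj Sx; exists r; rewrite inE rrs orbT.
exists rs; split=> // x; rewrite ltnS leq_eqVlt => /orP[/eqP xj Sx | ]; last exact: rsP.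
by case: nex; exists x; rewrite xj eqxx andbT; apply/asboolP.
Qed.

Theorem theorem1p3 (a : nat) (ha : 2 <= a) :
  exists rs : seq nat,
    [/\ rs <> [::],
        forall r : nat, r \in rs -> 0 < r &
        forall beta : nat,
          (2 <= beta /\ exists b : nat, a <= b /\ interesting_pair beta a b) <->
          (exists r : nat, r \in rs /\
             exists n : nat, beta = (a ^ 2 - 1) * n + r)].
Proof.
have K0 : 0 < a ^ 2 - 1 by nia.
set S := fun beta => 2 <= beta /\ exists b, a <= b /\ interesting_pair beta a b.
have Sshift x : S x -> S (x + (a ^ 2 - 1)).
  move=> [x2 [b [le_ab ab]]]; split; first by lia.
  exact: good_base_shift le_ab ab.
have [rs rsP] := shift_closed_progressions S _ K0 Sshift.
exists rs; split=> // [rs0 | r rrs].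
  have /rsP[r []] : S (3 * a ^ 2 + a - 4); last by rewrite rs0.
  split; first by nia.
  exists (4 * (3 * a ^ 2 + a - 4) + 3 * a + 1).
  by split; [lia | apply: interesting_pair_exists].
have [] : S r by apply/rsP; exists r; split=> //; exists 0; rewrite muln0.
by lia.
Qed.
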